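(* Suppose $X$ is a finite connected CW complex with $G=\pi_1(X,x_0)$, $\gamma\in\Gamma_X$, and $\tilde\chi'_1(X)$ is represented by a derivation $\Delta:\Gamma_X\to HH_1(\mathbb ZG)'$ such that $\Delta(\gamma)$ has a non-zero entry in exactly one component of $HH_1(\mathbb ZG)'=\bigoplus_{C\in\mathcal G(X)}HH_1(\mathbb ZG)_C$. Then the Gottlieb subgroup $\mathcal G(X)$ is cyclic and is generated by $\eta_\#(\gamma)$.
   Context: **Hochschild homology.** $HH_1(\mathbb ZG)$ is the first homology of the Hochschild complex with $d(s_1\otimes s_2\otimes m)=s_2\otimes ms_1-s_1s_2\otimes m+s_1\otimes s_2m$, $d(s\otimes m)=ms-sm$. Let $G_1$ be the set of conjugacy classes of $G$. A generating 1-chain $g\otimes m$ has marker $gm$; grouping by the class of the marker gives $HH_1(\mathbb ZG)=\bigoplus_{C\in G_1}HH_1(\mathbb ZG)_C$. **$\Gamma_X$.** $\Gamma_X=\pi_1(X^X,\mathrm{id})$, $X^X$ the space of self-maps with the compact-open topology. Evaluation at $x_0$ induces $\eta_\#:\Gamma_X\to G$ with image the Gottlieb subgroup $\mathcal G(X)$, contained in the center $Z(G)$ (so its elements are one-element conjugacy classes). $\pi':HH_1(\mathbb ZG)\to HH_1(\mathbb ZG)'$ is the projection. $\Gamma_X$ acts by $\gamma\cdot(g\otimes m)=g\otimes m\,\eta_\#(\gamma)^{-1}$. $H^1(\Gamma_X,M)$ is derivations ($\Delta(\gamma_1\gamma_2)=\Delta(\gamma_1)+\gamma_1\cdot\Delta(\gamma_2)$)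 modulo inner derivations ($\gamma\mapsto(1-\gamma)m$). **The invariant.** Orient the cells of $X$ and choose oriented lifts to the universal cover $\tilde X$, making $C_*(\tilde X)$ a based free right $\mathbb ZG$-complex (the covering transformation of $g$ acts by $c\mapsto cg^{-1}$). Represent $\gamma\in\Gamma_X$ by a cellular homotopy $F^\gamma:X\times I\to X$ from $\mathrm{id}$ to $\mathrm{id}$, lift it to $\tilde F^\gamma$ with $\tilde F^\gamma_0=\mathrm{id}$, and let $\tilde D^\gamma_k(\tilde e)=(-1)^{k+1}\tilde F^\gamma_*(\tilde e\times I)$. With $\tilde\partial=\bigoplus_k\tilde\partial_k$, $\tilde D^\gamma=\bigoplus_k(-1)^{k+1}\tilde D^\gamma_k$, $\widetilde{\mathcal X}_1(X)(\gamma)$ is the class of $\sum_{k,l}\tilde\partial_{kl}\otimes\tilde D^\gamma_{lk}$, a derivation. $\tilde\chi'_1(X)\in H^1(\Gamma_X,HH_1(\mathbb ZG)')$ is the class of $\pi'\circ\widetilde{\mathcal X}_1(X)$. *)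

(* Defs.v *)
From HB Require Import structures.
From mathcomp Require Import all_boot all_order all_algebra generic_quotient ring_quotient.
From mathcomp Require Import all_classical all_reals all_analysis.
From mathcomp Require Import lra.
From mathcomp Require Import homotopy freeg.

Set Implicit Arguments.
Unset Strict Implicit.
Unset Printing Implicit Defensive.

Import Order.TTheory GRing.Theory Num.Theory numFieldNormedType.Exports.
Import Quotient.Exports.

Local Open Scope classical_set_scope.
Local Open Scope quotient_scope.
Local Open Scope ring_scope.

Section UnitInterval.
Variable R : realType.

Definition unitI : Type := [set` `[(0 : R), 1]].

HB.instance Definition _ := Topological.on unitI.

Definition Ival (t : unitI) : R := set_val t.

Lemma clamp_in (x : R) :
  Num.max 0 (Num.min 1 x) \in ([set` `[(0 : R), 1]] : set R).
Proof. by rewrite inE /= in_itv /= le_max lexx /= ge_max ler01 ge_min lexx. Qed.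

(* Retraction of the line onto [0,1]: lets points of [0,1] be written as real
   expressions without carrying membership proofs. *)
Definition toI (x : R) : unitI :=
  @exist R (fun y => y \in [set` `[(0 : R), 1]]) _ (clamp_in x).

Lemma toIE x : Ival (toI x) = Num.max 0 (Num.min 1 x).
Proof. by []. Qed.

Lemma Ival_ge0 t : 0 <= Ival t.
Proof.
by have := set_valP t; rewrite /= in_itv /= => /andP[].
Qed.

Lemma Ival_le1 t : Ival t <= 1.
Proof.
by have := set_valP t; rewrite /= in_itv /= => /andP[].
Qed.

Lemma Ival_inj : injective Ival.
Proof. by move=> s t /val_inj. Qed.

Lemma toIK t : toI (Ival t) = t.
Proof.
by apply: Ival_inj; rewrite toIE (min_r (Ival_le1 _)) (max_r (Ival_ge0 _)).
Qed.

Lemma toIK_in x : 0 <= x <= 1 -> Ival (toI x) = x.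
Proof. by move=> /andP[? ?]; rewrite toIE min_r // max_r. Qed.

Lemma toI_neq : toI 0 != toI 1.
Proof.
apply/eqP => /(congr1 Ival); rewrite !toIK_in ?lexx ?ler01//.
by move/eqP; rewrite eq_sym oner_eq0.
Qed.

HB.instance Definition _ := @isBiPointed.Build unitI (toI 0) (toI 1) toI_neq.

Lemma Ival0 : Ival zero = 0.
Proof. by rewrite toIK_in // lexx ler01. Qed.

Lemma Ival1 : Ival one = 1.
Proof. by rewrite toIK_in // lexx ler01. Qed.

Lemma Ival_continuous : continuous Ival.
Proof. exact: initial_continuous. Qed.

Lemma toI_continuous : continuous toI.
Proof.
apply: continuous_comp_initial => x.
apply: (@continuous_max _ _ (cst 0)); first exact: cvg_cst.
by apply: (@continuous_min _ _ (cst 1)); [exact: cvg_cst | exact: cvg_id].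
Qed.

Lemma continuous_glue (T U : topologicalType) (h : T -> R) (c : R) (f g : T -> U) :
  continuous h -> continuous f -> continuous g ->
  (forall x, h x = c -> f x = g x) ->
  continuous (fun x => if h x <= c then f x else g x).
Proof.
move=> ch cf cg fg; apply/continuous_subspace_setT.
have -> : [set: T] = [set x | h x <= c] `|` [set x | c <= h x].
  by apply/seteqP; split=> x //= _; case: (leP (h x) c) => [|/ltW]; [left|right].
apply: withinU_continuous.
- apply: (@closed_comp _ _ h [set y | y <= c]); last exact: closed_le.
  by move=> x _; exact: ch.
- apply: (@closed_comp _ _ h [set y | c <= y]); last exact: closed_ge.
  by move=> x _; exact: ch.
- apply: (@subspace_eq_continuous _ _ _ f); last exact: continuous_subspaceT.
  move=> x /set_mem /= hxc. by rewrite /from_subspace hxc.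
- apply: (@subspace_eq_continuous _ _ _ g); last exact: continuous_subspaceT.
  move=> x /set_mem /= chx; rewrite /from_subspace; case: ifPn => // hxc.
  by apply/esym/fg/le_anti; rewrite hxc.
Qed.

End UnitInterval.

Notation loopType R X x := (@pathType (unitI R) X x x).

Section FundamentalGroup.
Variables (R : realType) (X : topologicalType) (x : X).
Notation I := (unitI R).
Notation loop := (loopType R X x).
Implicit Types p q r : loop.

Lemma continuous_comp2 (T U V W : topologicalType) (f : T -> U) (g : T -> V)
    (h : U * V -> W) :
  continuous f -> continuous g -> continuous h ->
  continuous (fun z => h (f z, g z)).
Proof.
move=> cf cg ch z.
apply: (@continuous_comp _ _ _ (fun z => (f z, g z)) h); last exact: ch.
by apply: cvg_pair; [exact: cf|exact: cg].
Qed.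

Lemma continuous_toI (T : topologicalType) (f : T -> R) :
  continuous f -> continuous (fun z => toI (f z)).
Proof.
move=> cf z; apply: (@continuous_comp _ _ _ f (@toI R)); first exact: cf.
exact: toI_continuous.
Qed.

Lemma continuous_loop (T : topologicalType) (f : T -> R) p :
  continuous f -> continuous (fun z => p (toI (f z))).
Proof.
move=> cf z; apply: (@continuous_comp _ _ _ (fun z => toI (f z)) p).
  exact: continuous_toI.
exact: cts_fun.
Qed.

Lemma continuous_I1 (T : topologicalType) : continuous (fun st : I * T => Ival st.1).
Proof.
move=> st; apply: (@continuous_comp _ _ _ fst (@Ival R)); last exact: Ival_continuous.
exact: cvg_fst.
Qed.

Lemma continuous_I2 (T : topologicalType) : continuous (fun st : T * I => Ival st.2).
Proof.
move=> st; apply: (@continuous_comp _ _ _ snd (@Ival R)); last exact: Ival_continuous.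
exact: cvg_snd.
Qed.

Lemma continuous_scaleB (T : topologicalType) (f : T -> R) (a b : R) :
  continuous f -> continuous (fun z => a * f z - b).
Proof.
move=> cf z; apply: cvgB; last exact: cvg_cst.
by apply: cvgM; [exact: cvg_cst|exact: cf].
Qed.

Lemma continuous_Bl (T : topologicalType) (f : T -> R) (a : R) :
  continuous f -> continuous (fun z => a - f z).
Proof.
move=> cf z; apply: (@continuousB R R T (cst a) f z); last exact: cf.
exact: cvg_cst.
Qed.

Lemma continuous_Dr (T : topologicalType) (f : T -> R) (a : R) :
  continuous f -> continuous (fun z => f z + a).
Proof. by move=> cf z; apply: cvgD; [exact: cf|exact: cvg_cst]. Qed.

Lemma continuous_Mr (T : topologicalType) (f : T -> R) (a : R) :
  continuous f -> continuous (fun z => f z * a).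
Proof. by move=> cf z; apply: cvgM; [exact: cf|exact: cvg_cst]. Qed.

Lemma continuous_scale (T : topologicalType) (f : T -> R) (a : R) :
  continuous f -> continuous (fun z => a * f z).
Proof. by move=> cf z; apply: cvgM; [exact: cvg_cst|exact: cf]. Qed.

Lemma cIval : continuous (@Ival R).
Proof. exact: Ival_continuous. Qed.

Lemma continuous_maxR (T : topologicalType) (f g : T -> R) :
  continuous f -> continuous g -> continuous (fun t => Num.max (f t) (g t)).
Proof. by move=> cf cg t; apply: continuous_max; [exact: cf|exact: cg]. Qed.

Lemma continuous_minR (T : topologicalType) (f g : T -> R) :
  continuous f -> continuous g -> continuous (fun t => Num.min (f t) (g t)).
Proof. by move=> cf cg t; apply: continuous_min; [exact: cf|exact: cg]. Qed.

Definition homotopic p q : Prop :=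
  exists H : I * I -> X, [/\ continuous H,
    (forall t, H (zero, t) = p t), (forall t, H (one, t) = q t) &
    (forall s, H (s, zero) = x /\ H (s, one) = x)].

Definition concat_fun p q (t : I) : X :=
  if Ival t <= 2^-1 then p (toI (2 * Ival t)) else q (toI (2 * Ival t - 1)).

Lemma concat_continuous p q : continuous (concat_fun p q).
Proof.
apply: continuous_glue.
- exact: Ival_continuous.
- exact/continuous_loop/continuous_scale/cIval.
- exact/continuous_loop/continuous_scaleB/cIval.
- by move=> t ->; rewrite divff ?pnatr_eq0// subrr path_one path_zero.
Qed.

Lemma concat0 p q : concat_fun p q zero = x.
Proof. by rewrite /concat_fun Ival0 invr_ge0 ler0n mulr0 path_zero. Qed.

Lemma concat1 p q : concat_fun p q one = x.
Proof.
rewrite /concat_fun Ival1 ifF; last by apply/negbTE; rewrite -ltNge; lra.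
by rewrite (_ : 2 * 1 - 1 = 1) ?path_one //; lra.
Qed.

Definition concat p q : loop :=
  mk_path (@concat_continuous p q) (concat0 p q) (concat1 p q).

Lemma concatE p q t : concat p q t = concat_fun p q t.
Proof. by []. Qed.

Lemma rev_continuous p : continuous (fun t : I => p (toI (1 - Ival t))).
Proof.
exact/continuous_loop/continuous_Bl/cIval.
Qed.

Lemma rev0 p : p (toI (1 - Ival zero)) = x.
Proof. by rewrite Ival0 subr0 path_one. Qed.

Lemma rev1 p : p (toI (1 - Ival one)) = x.
Proof. by rewrite Ival1 subrr path_zero. Qed.

Definition rev_loop p : loop := mk_path (@rev_continuous p) (rev0 p) (rev1 p).

Lemma rev_loopE p t : rev_loop p t = p (toI (1 - Ival t)).
Proof. by []. Qed.

Definition cst_loop : loop := cst x.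

Lemma homotopic_refl p : homotopic p p.
Proof.
exists (fun st => p st.2); split => //= [|s]; last by rewrite path_zero path_one.
move=> st; apply: (@continuous_comp _ _ _ snd p); last exact: cts_fun.
exact: cvg_snd.
Qed.

Lemma homotopic_sym p q : homotopic p q -> homotopic q p.
Proof.
move=> [H [cH H0 H1 Hx]]; exists (fun st => H (toI (1 - Ival st.1), st.2)).
split => [st|t|t|s]; last exact: Hx.
- move: st; apply: (continuous_comp2 (f := fun st : I * I => toI (1 - Ival st.1))
    (g := snd) (h := H)) => //; last by move=> ?; exact: cvg_snd.
  exact/continuous_toI/continuous_Bl/continuous_I1.
- by rewrite Ival0 subr0 H1.
- by rewrite Ival1 subrr H0.
Qed.

Lemma homotopic_trans p q r : homotopic p q -> homotopic q r -> homotopic p r.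
Proof.
move=> [H [cH H0 H1 Hx]] [K [cK K0 K1 Kx]].
exists (fun st => if Ival st.1 <= 2^-1 then H (toI (2 * Ival st.1), st.2)
                  else K (toI (2 * Ival st.1 - 1), st.2)); split.
- apply: continuous_glue; first exact: continuous_I1.
  + apply: (continuous_comp2 (f := fun st : I * I => toI (2 * Ival st.1))
      (g := snd) (h := H)) => //; last by move=> ?; exact: cvg_snd.
    exact/continuous_toI/continuous_scale/continuous_I1.
  + apply: (continuous_comp2 (f := fun st : I * I => toI (2 * Ival st.1 - 1))
      (g := snd) (h := K)) => //; last by move=> ?; exact: cvg_snd.
    exact/continuous_toI/continuous_scaleB/continuous_I1.
  + by move=> [s t] /= ->; rewrite divff ?pnatr_eq0// subrr H1 K0.
- by move=> t /=; rewrite Ival0 invr_ge0 ler0n mulr0 H0.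
- move=> t /=; rewrite Ival1 ifF; last by apply/negbTE; rewrite -ltNge; lra.
  by rewrite (_ : 2 * 1 - 1 = 1) ?K1 //; lra.
- by move=> s /=; case: ifP => _; [exact: Hx|exact: Kx].
Qed.

Lemma homotopic_concat p p' q q' :
  homotopic p p' -> homotopic q q' -> homotopic (concat p q) (concat p' q').
Proof.
move=> [H [cH H0 H1 Hx]] [K [cK K0 K1 Kx]].
exists (fun st => if Ival st.2 <= 2^-1 then H (st.1, toI (2 * Ival st.2))
                  else K (st.1, toI (2 * Ival st.2 - 1))); split.
- apply: continuous_glue; first exact: continuous_I2.
  + apply: (continuous_comp2 (f := fst)
      (g := fun st : I * I => toI (2 * Ival st.2)) (h := H)) => //; first by move=> ?; exact: cvg_fst.
    exact/continuous_toI/continuous_scale/continuous_I2.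
  + apply: (continuous_comp2 (f := fst)
      (g := fun st : I * I => toI (2 * Ival st.2 - 1)) (h := K)) => //; first by move=> ?; exact: cvg_fst.
    exact/continuous_toI/continuous_scaleB/continuous_I2.
  + move=> [s t] /= ->; rewrite divff ?pnatr_eq0// subrr.
    by rewrite (Hx s).2 (Kx s).1.
- by move=> t /=; rewrite !concatE /concat_fun; case: ifP.
- by move=> t /=; rewrite !concatE /concat_fun; case: ifP.
- move=> s /=; rewrite Ival0 Ival1 invr_ge0 ler0n mulr0 (Hx s).1; split => //.
  rewrite ifF; last by apply/negbTE; rewrite -ltNge; lra.
  by rewrite (_ : 2 * 1 - 1 = 1) ?(Kx s).2 //; lra.
Qed.

Lemma homotopic_rev p q : homotopic p q -> homotopic (rev_loop p) (rev_loop q).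
Proof.
move=> [H [cH H0 H1 Hx]]; exists (fun st => H (st.1, toI (1 - Ival st.2))); split.
- apply: (continuous_comp2 (f := fst)
    (g := fun st : I * I => toI (1 - Ival st.2)) (h := H)) => //;
    first by move=> ?; exact: cvg_fst.
  exact/continuous_toI/continuous_Bl/continuous_I2.
- by move=> t; rewrite H0.
- by move=> t; rewrite H1.
- by move=> s; rewrite Ival0 Ival1 subr0 subrr; have [] := Hx s.
Qed.

Lemma homotopic_reparam p (q r : loop) (f g : I -> R) :
  continuous f -> continuous g ->
  toI (f zero) = toI (g zero) -> toI (f one) = toI (g one) ->
  (forall t, 0 <= f t <= 1) -> (forall t, 0 <= g t <= 1) ->
  q =1 (fun t => p (toI (f t))) -> r =1 (fun t => p (toI (g t))) ->
  homotopic q r.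
Proof.
move=> cf cg e0 e1 f01 g01 qE rE.
exists (fun st => p (toI (f st.2 + Ival st.1 * (g st.2 - f st.2)))).
have fg0 : f zero = g zero.
  by move: e0 => /(congr1 (@Ival R)); rewrite !toIK_in.
have fg1 : f one = g one.
  by move: e1 => /(congr1 (@Ival R)); rewrite !toIK_in.
have c2 (h : I -> R) : continuous h -> continuous (fun st : I * I => h st.2).
  by move=> ch st; apply: (@continuous_comp _ _ _ snd h); [exact: cvg_snd|exact: ch].
split.
- apply: continuous_loop => st; apply: cvgD; first exact: c2.
  apply: cvgM; first exact: continuous_I1.
  by apply: cvgB; exact: c2.
- by move=> t /=; rewrite Ival0 mul0r addr0 qE.
- by move=> t /=; rewrite Ival1 mul1r addrC subrK rE.
- move=> s /=; rewrite fg0 fg1 !subrr !mulr0 !addr0.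
  by rewrite -(rE zero) -(rE one) path_zero path_one.
Qed.

Lemma homotopic_comp p (q : loop) (f : I -> R) :
  continuous f -> f zero = 0 -> f one = 1 -> (forall t, 0 <= f t <= 1) ->
  q =1 (fun t => p (toI (f t))) -> homotopic q p.
Proof.
move=> cf f0 f1 f01 qE.
apply: (@homotopic_reparam p q p f (@Ival R)) => //.
- exact: cIval.
- by rewrite f0 Ival0.
- by rewrite f1 Ival1.
- by move=> t; rewrite Ival_ge0 Ival_le1.
- by move=> t; rewrite toIK.
Qed.

Lemma concatA p q r :
  homotopic (concat (concat p q) r) (concat p (concat q r)).
Proof.
pose f (t : I) := Num.min (2 * Ival t) (Num.min (Ival t + 4^-1) ((Ival t + 1) / 2)).
have cf : continuous f.
  apply: continuous_minR; first exact/continuous_scale/cIval.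
  apply: continuous_minR; first exact/continuous_Dr/cIval.
  exact/continuous_Mr/continuous_Dr/cIval.
have fE (t : I) : f t = if Ival t <= 4^-1 then 2 * Ival t else
    if Ival t <= 2^-1 then Ival t + 4^-1 else (Ival t + 1) / 2.
  rewrite /f; have [h1|h1] := leP (Ival t + 4^-1) ((Ival t + 1) / 2).
    have [h2|h2] := leP (2 * Ival t) (Ival t + 4^-1);
    have [h3|h3] := leP (Ival t) 4^-1; have [h4|h4] := leP (Ival t) 2^-1; lra.
  have [h2|h2] := leP (2 * Ival t) ((Ival t + 1) / 2);
  have [h3|h3] := leP (Ival t) 4^-1; have [h4|h4] := leP (Ival t) 2^-1; lra.
apply: (@homotopic_comp _ _ f) => //.
- by rewrite fE Ival0 mulr0 invr_ge0 ler0n.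
- by rewrite fE Ival1 !ifF; [lra|apply/negbTE; rewrite -ltNge; lra..].
- move=> t; rewrite fE; have := Ival_ge0 t; have := Ival_le1 t => t1 t0.
  by do 2?[case: ifPn => [?|]; last rewrite -ltNge => ?]; apply/andP; split; lra.
- move=> t; have t0 := Ival_ge0 t; have t1 := Ival_le1 t.
  have f01 : 0 <= f t <= 1.
    by rewrite fE; do 2?[case: ifPn => [?|]; last rewrite -ltNge => ?]; apply/andP; split; lra.
  rewrite !concatE /concat_fun !concatE (toIK_in f01) fE /concat_fun.
  have [t4|t4] := leP (Ival t) 4^-1.
    rewrite !ifT ?toIK_in //; try (apply/andP; split); lra.
  have [t2|t2] := leP (Ival t) 2^-1.
    rewrite (toIK_in (x := 2 * Ival t)); last by apply/andP; split; lra.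
    rewrite ifF; last by apply/negbTE; rewrite -ltNge; lra.
    rewrite ifF; last by apply/negbTE; rewrite -ltNge; lra.
    rewrite toIK_in; last by apply/andP; split; lra.
    rewrite ifT; last by lra.
    by congr (q (toI _)); lra.
  rewrite ifF; last by apply/negbTE; rewrite -ltNge; lra.
  rewrite toIK_in; last by apply/andP; split; lra.
  rewrite ifF; last by apply/negbTE; rewrite -ltNge; lra.
  by congr (r (toI _)); lra.
Qed.

Lemma concat1p p : homotopic (concat cst_loop p) p.
Proof.
pose f (t : I) := Num.max 0 (2 * Ival t - 1).
apply: (@homotopic_comp _ _ f) => //.
- by apply: continuous_maxR; [exact: cst_continuous|exact/continuous_scaleB/cIval].
- by rewrite /f Ival0 max_l //; lra.
- by rewrite /f Ival1 max_r //; lra.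
- move=> t; rewrite /f le_max lexx ge_max ler01 /=.
  by have := Ival_le1 t; lra.
- move=> t; rewrite !concatE /concat_fun /f.
  have [t2|t2] := leP (Ival t) 2^-1.
    by rewrite max_l ?path_zero //; lra.
  by rewrite max_r //; lra.
Qed.

Lemma concatp1 p : homotopic (concat p cst_loop) p.
Proof.
pose f (t : I) := Num.min 1 (2 * Ival t).
apply: (@homotopic_comp _ _ f) => //.
- by apply: continuous_minR; [exact: cst_continuous|exact/continuous_scale/cIval].
- by rewrite /f Ival0 min_r //; lra.
- by rewrite /f Ival1 min_l //; lra.
- move=> t; rewrite /f le_min ge_min lexx ler01 /= andbT.
  by have := Ival_ge0 t; lra.
- move=> t; rewrite !concatE /concat_fun /f.
  have [t2|t2] := leP (Ival t) 2^-1.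
    by rewrite min_r //; lra.
  by rewrite min_l ?path_one //; lra.
Qed.

Lemma concatpV p : homotopic (concat p (rev_loop p)) cst_loop.
Proof.
pose f (t : I) := Num.min (2 * Ival t) (2 - 2 * Ival t).
apply: (@homotopic_reparam p _ _ f (fun=> 0)).
- apply: continuous_minR; first exact/continuous_scale/cIval.
  exact/continuous_Bl/continuous_scale/cIval.
- exact: cst_continuous.
- by rewrite /f Ival0 min_l //; last lra; rewrite mulr0.
- by rewrite /f Ival1 min_r //; last lra; congr toI; lra.
- move=> t; rewrite /f le_min ge_min; have := Ival_ge0 t; have := Ival_le1 t.
  have [] := leP (Ival t) 2^-1 => ? ? ?; apply/andP; split.
  + by apply/andP; split; lra.
  + by apply/orP; left; lra.
  + by apply/andP; split; lra.
  + by apply/orP; right; lra.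
- by move=> t; rewrite lexx ler01.
- move=> t; have t0 := Ival_ge0 t; have t1 := Ival_le1 t.
  rewrite concatE /concat_fun /f.
  have [t2|t2] := leP (Ival t) 2^-1; first by rewrite min_l //; lra.
  rewrite min_r; last lra.
  rewrite !rev_loopE toIK_in; last by apply/andP; split; lra.
  by congr (p (toI _)); lra.
- by move=> t; rewrite path_zero.
Qed.

Lemma rev_loopK p : rev_loop (rev_loop p) = p.
Proof.
apply/path_eqP => t; rewrite !rev_loopE.
have t0 := Ival_ge0 t; have t1 := Ival_le1 t.
rewrite toIK_in; last by apply/andP; split; lra.
by rewrite opprB addrC subrK toIK.
Qed.

Lemma concatVp p : homotopic (concat (rev_loop p) p) cst_loop.
Proof. by rewrite -{2}(rev_loopK p); exact: concatpV. Qed.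

Lemma homotopic_equiv : equiv_class_of (fun p q => `[< homotopic p q >]).
Proof.
split=> [p|p q|q p r].
- exact/asboolP/homotopic_refl.
- by apply/asboolP/asboolP; exact: homotopic_sym.
- by move=> /asboolP pq /asboolP qr; apply/asboolP/(homotopic_trans pq qr).
Qed.

Canonical homotopic_equivRel := EquivRelPack homotopic_equiv.

Definition pi1 : Type := {eq_quot homotopic_equivRel}.
HB.instance Definition _ := Choice.on pi1.
HB.instance Definition _ := EqQuotient.on pi1.

Definition pi1_class (p : loop) : pi1 := \pi_pi1 p.

Lemma pi1_classP p q : reflect (homotopic p q) (pi1_class p == pi1_class q).
Proof.
by apply: (iffP idP) => [/eqP/eqmodP/asboolP//|h]; apply/eqP/eqmodP/asboolP.
Qed.

Lemma pi1_classK (g : pi1) : pi1_class (repr g) = g.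
Proof. exact: reprK. Qed.

Definition pi1_mul (g h : pi1) : pi1 := pi1_class (concat (repr g) (repr h)).
Definition pi1_inv (g : pi1) : pi1 := pi1_class (rev_loop (repr g)).
Definition pi1_one : pi1 := pi1_class cst_loop.

Lemma homotopic_repr p : homotopic (repr (pi1_class p)) p.
Proof. by apply/pi1_classP; rewrite pi1_classK. Qed.

Lemma pi1_mulE p q : pi1_mul (pi1_class p) (pi1_class q) = pi1_class (concat p q).
Proof. by apply/eqP/pi1_classP/homotopic_concat; exact: homotopic_repr. Qed.

Lemma pi1_invE p : pi1_inv (pi1_class p) = pi1_class (rev_loop p).
Proof. by apply/eqP/pi1_classP/homotopic_rev; exact: homotopic_repr. Qed.

Lemma pi1_mulA : associative pi1_mul.
Proof.
move=> g h k; rewrite -(pi1_classK g) -(pi1_classK h) -(pi1_classK k) !pi1_mulE.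
by apply/esym/eqP/pi1_classP/concatA.
Qed.

Lemma pi1_mul1g : left_id pi1_one pi1_mul.
Proof.
by move=> g; rewrite -(pi1_classK g) pi1_mulE; apply/eqP/pi1_classP/concat1p.
Qed.

Lemma pi1_mulg1 : right_id pi1_one pi1_mul.
Proof.
by move=> g; rewrite -(pi1_classK g) pi1_mulE; apply/eqP/pi1_classP/concatp1.
Qed.

Lemma pi1_mulVg : left_inverse pi1_one pi1_inv pi1_mul.
Proof.
move=> g; rewrite -(pi1_classK g) pi1_invE pi1_mulE.
exact/eqP/pi1_classP/concatVp.
Qed.

Lemma pi1_mulgV : right_inverse pi1_one pi1_inv pi1_mul.
Proof.
move=> g; rewrite -(pi1_classK g) pi1_invE pi1_mulE.
exact/eqP/pi1_classP/concatpV.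
Qed.

HB.instance Definition _ := isGroup.Build pi1
  pi1_mulA pi1_mul1g pi1_mulg1 pi1_mulVg pi1_mulgV.

End FundamentalGroup.

Section Functoriality.
Variables (R : realType) (X Y : topologicalType) (f : continuousType X Y) (x : X).

Definition pi1_map (g : pi1 R x) : pi1 R (f x) :=
  pi1_class (f \o repr g : loopType R Y (f x)).

Lemma homotopic_map (p q : loopType R X x) :
  homotopic p q ->
  homotopic (f \o p : loopType R Y (f x)) (f \o q : loopType R Y (f x)).
Proof.
move=> [H [cH H0 H1 Hx]]; exists (f \o H); split.
- by move=> st; apply: continuous_comp; [exact: cH | exact: cts_fun].
- by move=> t /=; rewrite H0.
- by move=> t /=; rewrite H1.
- by move=> s /=; have [-> ->] := Hx s.
Qed.

Lemma pi1_mapE (p : loopType R X x) :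
  pi1_map (pi1_class p) = pi1_class (f \o p : loopType R Y (f x)).
Proof. by apply/eqP/pi1_classP/homotopic_map; exact: homotopic_repr. Qed.

Lemma pi1_mapM : {morph pi1_map : g h / (g * h)%g}.
Proof.
move=> g h; rewrite -(pi1_classK g) -(pi1_classK h) [(_ * _)%g]pi1_mulE !pi1_mapE.
rewrite [RHS]pi1_mulE; congr pi1_class; apply/path_eqP => t.
by rewrite !concatE /= concatE /concat_fun; case: ifP.
Qed.

End Functoriality.

Definition selfmaps (X : topologicalType) : Type := continuousType X X.

HB.instance Definition _ (X : topologicalType) := Topological.copy (selfmaps X)
  (initial_topology (id : continuousType X X -> {compact-open, X -> X})).

Definition selfid (X : topologicalType) : selfmaps X := [the continuousType X X of idfun].

Section Gottlieb.
Variables (R : realType) (X : topologicalType) (x0 : X).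

Definition ev (f : selfmaps X) : X := (f : continuousType X X) x0.

Lemma ev_continuous : continuous ev.
Proof.
pose w (f : selfmaps X) : {compact-open, X -> X} := f : continuousType X X.
have cw : continuous w by exact: initial_continuous.
move=> f; apply: (@continuous_comp _ _ _ w (fun g => g x0)); first exact: cw.
move=> U; rewrite nbhsE /= => -[V [oV Vf] VU].
apply: (@filterS _ (nbhs (w f)) _ [set g : {compact-open, X -> X} | g @` [set x0] `<=` V]).
  by move=> g /= gV; apply/VU/gV; exists x0.
apply: open_nbhs_nbhs; split; last by move=> _ [_ -> <-].
by apply: compact_open_open => //; exact: compact_set1.
Qed.

Definition Gamma : Type := pi1 R (selfid X).
HB.instance Definition _ := monoid.Group.on Gamma.

Definition eta_sharp (g : Gamma) : pi1 R x0 := pi1_map (mkcts ev_continuous) g.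

Definition Gottlieb : set (pi1 R x0) := range eta_sharp.
End Gottlieb.
Arguments Gamma R X : clear implicits.
Arguments Gottlieb R {X} x0 _ : rename.

Section FreeAbelian.
Variables (K L : choiceType).

Definition fgpush (f : K -> L) : {freeg K} -> {freeg L} :=
  fglift (fun k => << f k >>).

Definition fgrestrict (S : set K) : {freeg K} -> {freeg K} :=
  fglift (fun k => if `[< S k >] then << k >> else 0).

Definition fgtensor (a : {freeg K}) (b : {freeg L}) : {freeg (K * L)%type} :=
  fglift (fun k => fglift (fun l => << (k, l) >>) b) a.
End FreeAbelian.

Section Hochschild.
Variable G : groupType.

(* The n-th group of the Hochschild complex, the (n+1)-fold tensor power of ZG, is
   free on G^(n+1); the last entry is the coefficient m. *)
Definition HC0 := {freeg G}.
Definition HC1 := {freeg (G * G)%type}.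
Definition HC2 := {freeg (G * G * G)%type}.

Definition hd1 : HC1 -> HC0 :=
  fglift (fun '(s, m) => << (m * s)%g >> - << (s * m)%g >>).

Definition hd2 : HC2 -> HC1 :=
  fglift (fun '(s1, s2, m) =>
    << (s2, (m * s1)%g) >> - << ((s1 * s2)%g, m) >> + << (s1, (s2 * m)%g) >>).

Lemma fglift_raddf (K : choiceType) (M : lmodType int) (f : K -> M) :
  {morph fglift f : a b / a - b}.
Proof. exact: lift_is_additive. Qed.

Lemma fglift0 (K : choiceType) (M : lmodType int) (f : K -> M) : fglift f 0 = 0.
Proof. by rewrite -(subrr 0) fglift_raddf subrr. Qed.

Definition hcycle : {pred {freeg (G * G)%type}} := fun c => hd1 c == 0.

Lemma hcycle_closed : zmod_closed hcycle.
Proof.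
split=> [|a b]; first by rewrite /in_mem /= /hcycle /hd1 fglift0.
by rewrite /in_mem /= /hcycle /hd1 fglift_raddf => /eqP -> /eqP ->; rewrite subrr.
Qed.
HB.instance Definition _ := GRing.isZmodClosed.Build _ hcycle hcycle_closed.

Record HZ1 : Type := HCycle { hcycle_val :> {freeg (G * G)%type}; _ : hcycle_val \in hcycle }.
HB.instance Definition _ := [isSub for hcycle_val].
HB.instance Definition _ := [Choice of HZ1 by <:].
HB.instance Definition _ := [SubChoice_isSubZmodule of HZ1 by <:].

Definition hboundary : {pred HZ1} := fun z => `[< exists b, hd2 b = val z >].

Lemma hboundary_closed : zmod_closed hboundary.
Proof.
split=> [|a b]; first by apply/asboolP; exists 0; rewrite /hd2 fglift0 raddf0.
move=> /asboolP[u ua] /asboolP[v vb]; apply/asboolP; exists (u - v).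
by rewrite /hd2 fglift_raddf -/hd2 ua vb raddfB.
Qed.
HB.instance Definition _ := GRing.isZmodClosed.Build HZ1 hboundary hboundary_closed.

Definition HH1 : Type := @Quotient.quot HZ1 hboundary.
HB.instance Definition _ := GRing.Zmodule.on HH1.
HB.instance Definition _ := EqQuotient.on HH1.

Definition HH1_class (z : HZ1) : HH1 := \pi_HH1 z.

Definition represents (c : HC1) (x : HH1) : Prop :=
  exists2 z : HZ1, hcycle_val z = c & HH1_class z = x.

(* The endomorphism induced by f if f maps cycles to cycles and boundaries to
   boundaries (see [HH1_mapE]); insubd 0 only serves to make it total. *)
Definition HH1_map (f : HC1 -> HC1) (x : HH1) : HH1 :=
  HH1_class (insubd 0 (f (val (repr x)))).

Lemma HH1_classP (z w : HZ1) :
  reflect (exists b, hd2 b = val z - val w) (HH1_class z == HH1_class w).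
Proof.
rewrite /HH1_class; have <- := @Quotient.idealrBE _ hboundary z w.
rewrite -[_ \in _]/(`[< exists b, hd2 b = val (z - w) >]) raddfB.
exact: asboolP.
Qed.

Lemma HH1_mapE (f : {freeg (G * G)%type} -> {freeg (G * G)%type}) (z : HZ1) :
  {morph f : a b / a - b} ->
  (forall c, hd1 c = 0 -> hd1 (f c) = 0) ->
  (forall b, exists b', hd2 b' = f (hd2 b)) ->
  represents (f (val z)) (HH1_map f (HH1_class z)).
Proof.
move=> fB fZ fd.
have fin (w : HZ1) : f (val w) \in hcycle.
  by apply/eqP/fZ/eqP; case: w.
pose g w : HZ1 := HCycle (fin w).
have vg w : insubd (0 : HZ1) (f (val w)) = g w.
  by apply: val_inj; rewrite val_insubd fin.
exists (g z) => //; rewrite /HH1_map vg; apply/eqP/HH1_classP => /=.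
have /eqP/HH1_classP[b hb] : HH1_class (repr (HH1_class z)) = HH1_class z.
  by rewrite /HH1_class reprK.
have [b' hb'] := fd b; exists (- b').
rewrite -[in LHS](sub0r b') /hd2 fglift_raddf fglift0 -/hd2 hb' hb fB sub0r.
by rewrite opprB.
Qed.

Definition marker (s : G * G) : G := (s.1 * s.2)%g.

Definition conj_class (c : G) : set G := [set y | exists a, y = (a^-1 * c * a)%g].

(* For S a union of conjugacy classes, HH1_at S is the sum of the HH_1(ZG)_C with
   C contained in S, and HH1_proj S the projection onto it (see [HH1_projE]). *)
Definition HH1_at (S : set G) : set HH1 :=
  [set x | exists2 c, represents c x & forall s, s \in dom c -> S (marker s)].

Definition HH1_proj (S : set G) : HH1 -> HH1 :=
  HH1_map (fgrestrict [set s | S (marker s)]).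

(* g (x) m |-> g (x) m z, which is a chain map for central z (see [HH1_rmulE]). *)
Definition HH1_rmul (z : G) : HH1 -> HH1 :=
  HH1_map (fgpush (fun s => (s.1, (s.2 * z)%g))).

Lemma freegP (K : choiceType) (P : {freeg K} -> Prop) :
  P 0 -> (forall k, P << k >>) -> (forall a b, P a -> P b -> P (a - b)) ->
  forall a, P a.
Proof.
move=> P0 P1 PB.
have PN a : P a -> P (- a) by move=> Pa; rewrite -sub0r; exact: PB.
have PD a b : P a -> P b -> P (a + b) by move=> Pa Pb; rewrite -(opprK b); apply/PB/PN.
have PM a n : P a -> P (a *+ n).
  by move=> Pa; elim: n => [|n IH]; rewrite ?mulr0n ?mulrS //; exact: PD.
move=> a; rewrite -(freeg_sumE a); apply: big_ind => // k _.
rewrite -[coeff k a]intz -freegU_mulz.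
by case: (coeff k a) => n; [exact: PM|exact/PN/PM].
Qed.

Lemma fglift1 (K : choiceType) (M : lmodType int) (f : K -> M) k :
  fglift f << k >> = f k.
Proof. by rewrite liftU scale1r. Qed.

Lemma HH1_projE (S : set G) (z : HZ1) :
  (forall c a, S c -> S (a^-1 * c * a)%g) ->
  represents (fgrestrict [set s | S (marker s)] (val z))
             (HH1_proj S (HH1_class z)).
Proof.
move=> Sconj.
have SJ (a b : G) : S (a * b)%g = S (b * a)%g.
  apply/propext; split=> /Sconj; first by move/(_ a); rewrite !mulgA mulVg mul1g.
  by move/(_ b); rewrite !mulgA mulVg mul1g.
pose r0 := @fgrestrict G S.
pose r2 := @fgrestrict (G * G * G)%type [set s | S (s.1.1 * s.1.2 * s.2)%g].
pose r1 := @fgrestrict (G * G)%type [set s | S (marker s)].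
have hB0 : {morph hd1 : a b / a - b} by exact: fglift_raddf.
have hB2 : {morph hd2 : a b / a - b} by exact: fglift_raddf.
have rB0 : {morph r0 : a b / a - b} by exact: fglift_raddf.
have rB1 : {morph r1 : a b / a - b} by exact: fglift_raddf.
have rB2 : {morph r2 : a b / a - b} by exact: fglift_raddf.
have c1 c : hd1 (r1 c) = r0 (hd1 c).
  elim/freegP: c => [|[s m]|a b aE bE].
  - by rewrite /hd1 /r1 /r0 /fgrestrict !fglift0.
  - rewrite /r1 /fgrestrict fglift1 {2}/hd1 fglift1 /= rB0 /r0 /fgrestrict !fglift1.
    rewrite /marker /= (SJ m s); case: asboolP => _; rewrite ?subrr.
      by rewrite /hd1 fglift1.
    by rewrite /hd1 fglift0.
  - by rewrite rB1 hB0 aE bE hB0 rB0.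
have c2 c : hd2 (r2 c) = r1 (hd2 c).
  elim/freegP: c => [|[[s t] m]|a b aE bE].
  - by rewrite /hd2 /r1 /r2 /fgrestrict !fglift0.
  - have rD a b : r1 (a + b) = r1 a + r1 b.
      have r1N w : r1 (- w) = - r1 w by rewrite -sub0r rB1 /r1 /fgrestrict fglift0 sub0r.
      by rewrite -{1}(opprK b) rB1 r1N opprK.
    rewrite /r2 /fgrestrict fglift1 {2}/hd2 fglift1 /= rD rB1 /r1 /fgrestrict !fglift1.
    rewrite /marker /= -[(s * t * m)%g]mulgA (SJ s) !mulgA (SJ _ s) !mulgA.
    case: asboolP => _; rewrite ?subrr ?addr0.
      by rewrite /hd2 fglift1 /= ?mulgA.
    by rewrite /hd2 fglift0.
  - by rewrite rB2 hB2 aE bE hB2 rB1.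
apply: HH1_mapE => //.
- by move=> c c0; rewrite c1 c0 /r0 /fgrestrict fglift0.
- by move=> b; exists (r2 b).
Qed.

Lemma HH1_rmulE (z : G) (w : HZ1) : (forall g, (z * g = g * z)%g) ->
  represents (fgpush (fun s => (s.1, (s.2 * z)%g)) (val w))
             (HH1_rmul z (HH1_class w)).
Proof.
move=> zC.
pose r0 := fgpush (fun m : G => (m * z)%g).
pose r2 := fgpush (fun s : G * G * G => (s.1, (s.2 * z)%g)).
pose r1 := fgpush (fun s : G * G => (s.1, (s.2 * z)%g)).
have hB0 : {morph hd1 : a b / a - b} by exact: fglift_raddf.
have hB2 : {morph hd2 : a b / a - b} by exact: fglift_raddf.
have rB0 : {morph r0 : a b / a - b} by exact: fglift_raddf.
have rB1 : {morph r1 : a b / a - b} by exact: fglift_raddf.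
have rB2 : {morph r2 : a b / a - b} by exact: fglift_raddf.
have c1 c : hd1 (r1 c) = r0 (hd1 c).
  elim/freegP: c => [|[s m]|a b aE bE].
  - by rewrite /hd1 /r1 /r0 /fgpush !fglift0.
  - rewrite /r1 /fgpush fglift1 {2}/hd1 fglift1 /= rB0 /r0 /fgpush !fglift1.
    by rewrite /hd1 fglift1 /= -!mulgA zC.
  - by rewrite rB1 hB0 aE bE hB0 rB0.
have c2 c : hd2 (r2 c) = r1 (hd2 c).
  elim/freegP: c => [|[[s t] m]|a b aE bE].
  - by rewrite /hd2 /r1 /r2 /fgpush !fglift0.
  - have rD a b : r1 (a + b) = r1 a + r1 b.
      have r1N v : r1 (- v) = - r1 v by rewrite -sub0r rB1 /r1 /fgpush fglift0 sub0r.
      by rewrite -{1}(opprK b) rB1 r1N opprK.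
    rewrite /r2 /fgpush fglift1 {2}/hd2 fglift1 /= rD rB1 /r1 /fgpush !fglift1.
    by rewrite /hd2 fglift1 /= -!mulgA zC.
  - by rewrite rB2 hB2 aE bE hB2 rB1.
apply: HH1_mapE => //.
- by move=> c c0; rewrite c1 c0 /r0 /fgpush fglift0.
- by move=> b; exists (r2 b).
Qed.

End Hochschild.

Section StandardSimplex.
Variable R : realType.

Definition stdsimplex (n : nat) : Type :=
  [set t : 'rV[R]_n.+1 | (forall i, 0 <= t ord0 i) /\ \sum_i t ord0 i = 1].
HB.instance Definition _ n := Topological.on (stdsimplex n).

Definition bary n (t : stdsimplex n) (i : 'I_n.+1) : R := (set_val t) ord0 i.

Section VertexMap.
Variables (m n : nat) (f : 'I_m.+1 -> 'I_n.+1).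

Definition vertex_row (t : stdsimplex m) : 'rV[R]_n.+1 :=
  \row_j \sum_(i | f i == j) bary t i.

Lemma vertex_row_in (t : stdsimplex m) : vertex_row t \in
  [set t : 'rV[R]_n.+1 | (forall i, 0 <= t ord0 i) /\ \sum_i t ord0 i = 1].
Proof.
have [t0 t1] := set_valP t; rewrite inE /=; split.
  by move=> j; rewrite mxE; apply: sumr_ge0 => i _; exact: t0.
under eq_bigr do rewrite mxE.
by rewrite -[RHS]t1 [RHS](partition_big f xpredT).
Qed.

Definition vertex_map (t : stdsimplex m) : stdsimplex n :=
  @exist _ (fun t => t \in _) _ (vertex_row_in t).
End VertexMap.

End StandardSimplex.

Section SingularChains.
Variable R : realType.

Definition simplex (Y : Type) : Type := {n : nat & stdsimplex R n -> Y}.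

(* The free group on all maps from standard simplices; singular chains are those
   supported on continuous ones (see [singular_in]). All degrees together. *)
Notation chain Y := {freeg {classic simplex Y}}.

Definition simplex_chain Y n (s : stdsimplex R n -> Y) : chain Y :=
  << (existT _ n s : {classic simplex Y}) >>.

Definition face_sum Y n : (stdsimplex R n -> Y) -> chain Y :=
  if n is m.+1 then fun s =>
    \sum_(i < m.+2) (-1) ^+ i *: simplex_chain (s \o vertex_map (fintype.lift i))
  else fun=> 0.

Definition bd Y : chain Y -> chain Y :=
  fglift (fun s : {classic simplex Y} => face_sum (projT2 (s : simplex Y))).

Definition push Y Z (f : Y -> Z) : chain Y -> chain Z :=
  fgpush (fun s : {classic simplex Y} =>
    existT _ (projT1 s) (f \o projT2 (s : simplex Y)) : {classic simplex Z}).

Definition homogeneous Y n (c : chain Y) : Prop :=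
  forall s : simplex Y, (s : {classic simplex Y}) \in dom c -> projT1 s = n.

Definition singular_in (Y : topologicalType) (A : set Y) (c : chain Y) : Prop :=
  forall s : simplex Y, (s : {classic simplex Y}) \in dom c ->
    continuous (projT2 s) /\ forall t, A (projT2 s t).

Definition rel_cycle (Y : topologicalType) (A B : set Y) n (c : chain Y) : Prop :=
  [/\ homogeneous n c, singular_in A c & singular_in B (bd c)].

(* Equality of the classes of c and c' in H_*(A, B), for B contained in A *)
Definition homologous (Y : topologicalType) (A B : set Y) (c c' : chain Y) : Prop :=
  exists b a, [/\ singular_in A b, singular_in B a & c - c' = bd b + a].

(* F composed with the i-th simplex [v_0 .. v_i w_i .. w_n] of the prism: its k-th
   vertex lies at height 0 for k <= i and at height 1 for k > i. *)
Definition prism_simplex Y Z (F : Y * unitI R -> Z) n (s : stdsimplex R n -> Y)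
    (i : 'I_n.+1) (t : stdsimplex R n.+1) : Z :=
  F (s (vertex_map (fun k => inord (unbump i k)) t),
     toI (\sum_(k < n.+2 | (i < k)%N) bary t k)).

(* F_*(c x I), with the product orientation.  The prism operator P satisfies
   dP + Pd = i_1 - i_0, i.e. it is I x -, and c x I = (-1)^n (I x c). *)
Definition push_prism Y Z (F : Y * unitI R -> Z) : chain Y -> chain Z :=
  fglift (fun s : {classic simplex Y} => (-1) ^+ projT1 s *:
    \sum_(i < (projT1 s).+1)
      (-1) ^+ i *: simplex_chain (prism_simplex F (projT2 (s : simplex Y)) i)).

End SingularChains.
Notation chain R Y := {freeg {classic simplex R Y}}.

Section Disk.
Variables (R : realType) (k : nat).

Definition disk : Type := [set v : 'rV[R]_k | \sum_i v ord0 i ^+ 2 <= 1].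
HB.instance Definition _ := Topological.on disk.

Definition sqnorm (v : disk) : R := \sum_i (set_val v) ord0 i ^+ 2.

Definition open_disk : set disk := [set v | sqnorm v < 1].
Definition sphere : set disk := [set v | sqnorm v = 1].

(* o represents a generator of H_k(D^k, S^(k-1)), which is infinite cyclic. *)
Definition orientation (o : chain R disk) : Prop :=
  rel_cycle setT sphere k o /\
  forall c, rel_cycle setT sphere k c ->
    exists n : int, homologous setT sphere c (n *: o).
End Disk.

Record finCW (R : realType) (X : topologicalType) := FinCW {
  cell : finType;
  cdim : cell -> nat;
  charmap : forall e, disk R (cdim e) -> X;
  _ : hausdorff_space X;
  _ : forall e, continuous (@charmap e);
  (* the characteristic maps are injective on open disks and the open cells
     partition X *)
  _ : forall y : X, exists! u : {e : cell & disk R (cdim e)},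
        open_disk (projT2 u) /\ charmap (projT2 u) = y;
  _ : forall e (v : disk R (cdim e)), sphere v ->
        exists e' (v' : disk R (cdim e')), (cdim e' < cdim e)%N /\
          charmap v = charmap v' }.

(* skel K n is the (n-1)-skeleton; skel K 0 is empty. *)
Definition skel (R : realType) (X : topologicalType) (K : finCW R X) (n : nat) : set X :=
  [set y | exists (e : cell K) (v : disk R (cdim e)), (cdim e < n)%N /\ charmap v = y].

Definition evenly_covered (E X : topologicalType) (p : E -> X) (U : set X) : Prop :=
  exists (J : Type) (V : J -> set E),
    [/\ forall j, open (V j), trivIset setT V, p @^-1` U = \bigcup_j V j &
        forall j, exists s : X -> E, [/\ {within U, continuous s},
          forall y, U y -> V j (s y) /\ p (s y) = y & forall z, V j z -> s (p z) = z]].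

Definition covering (E X : topologicalType) (p : E -> X) : Prop :=
  continuous p /\ forall y, exists U : set X, open_nbhs y U /\ evenly_covered p U.

Definition simply_connected (R : realType) (E : topologicalType) : Prop :=
  (forall y z : E, inhabited (@pathType (unitI R) E y z)) /\
  (forall (y : E) (p : loopType R E y), homotopic p (cst_loop R y)).

Record universal_cover (R : realType) (X : topologicalType) (x0 : X) := UniversalCover {
  cover_space : topologicalType;
  cover_proj : cover_space -> X;
  cover_base : cover_space;
  deck : pi1 R x0 -> cover_space -> cover_space;
  _ : covering cover_proj;
  _ : simply_connected R cover_space;
  _ : cover_proj cover_base = x0;
  (* deck g is the covering transformation taking the base point to the end point
     of the lift of g; it is determined by this. *)
  _ : forall g, [/\ continuous (deck g), forall y, cover_proj (deck g y) = cover_proj y &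
        exists (p : loopType R X x0) (q : unitI R -> cover_space),
          [/\ pi1_class p = g, continuous q, forall t, cover_proj (q t) = p t,
              q zero = cover_base & q one = deck g cover_base]] }.

Record cell_lifts (R : realType) (X : topologicalType) (x0 : X) (K : finCW R X)
    (U : universal_cover R x0) := CellLifts {
  clift : forall e : cell K, disk R (cdim e) -> cover_space U;
  corient : forall e : cell K, chain R (disk R (cdim e));
  _ : forall e, continuous (@clift e);
  _ : forall e v, cover_proj (@clift e v) = charmap v;
  _ : forall e, orientation (corient e) }.

Section Invariant.
Variables (R : realType) (X : topologicalType) (x0 : X) (K : finCW R X).
Variables (U : universal_cover R x0) (L : cell_lifts K U).
Notation G := (pi1 R x0).
Notation E := (cover_space U).

Definition skel_cover (n : nat) : set E := @cover_proj _ _ _ U @^-1` skel K n.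

(* The basis element of H_k(X~^k, X~^(k-1)) given by the lift of the cell e. *)
Definition cell_chain (e : cell K) : chain R E := push (clift L (e:=e)) (corient L e).

(* right ZG-module structure: c . g is the image of c under the covering
   transformation of g^-1 *)
Definition ract (c : chain R E) (a : {freeg G}) : chain R E :=
  fglift (fun g : G => push (deck (u:=U) g^-1%g) c) a.

(* The image of e_j is sum_i e_i M_ij. *)
Definition combination (M : cell K -> cell K -> {freeg G}) (j : cell K) : chain R E :=
  \sum_i ract (cell_chain i) (M i j).

(* Matrix of the cellular boundary, the connecting map
   H_k(X~^k, X~^(k-1)) -> H_(k-1)(X~^(k-1), X~^(k-2)), in all degrees at once. *)
Definition boundary_matrix (M : cell K -> cell K -> {freeg G}) : Prop :=
  (forall i j, (cdim i).+1 <> cdim j -> M i j = 0) /\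
  forall j, homologous (skel_cover (cdim j)) (skel_cover (cdim j).-1)
    (bd (cell_chain j)) (combination M j).

(* Matrix of the D_k : e |-> (-1)^(k+1) F_*(e x I), in all degrees k at once. *)
Definition homotopy_matrix (F : E * unitI R -> E) (M : cell K -> cell K -> {freeg G}) : Prop :=
  (forall i j, cdim i <> (cdim j).+1 -> M i j = 0) /\
  forall j, homologous (skel_cover (cdim j).+2) (skel_cover (cdim j).+1)
    ((-1) ^+ (cdim j).+1 *: push_prism F (cell_chain j)) (combination M j).

(* The direct sum of the (-1)^(k+1) D_k, a sign on top of the one in D_k. *)
Definition total_homotopy (M : cell K -> cell K -> {freeg G}) (i j : cell K) : {freeg G} :=
  (-1) ^+ (cdim j).+1 *: M i j.

Definition trace_chain (M N : cell K -> cell K -> {freeg G}) : HC1 G :=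
  \sum_k \sum_l fgtensor (M k l) (N l k).

Definition cellular_homotopy (g : Gamma R X) (F : X * unitI R -> X) : Prop :=
  [/\ continuous F,
      exists2 w : loopType R (selfmaps X) (selfid X), pi1_class w = g &
        forall y t, F (y, t) = (w t : continuousType X X) y &
      forall n y t, skel K n y -> skel K n.+1 (F (y, t))].

Definition lifted_homotopy (F : X * unitI R -> X) (F' : E * unitI R -> E) : Prop :=
  [/\ continuous F', forall y t, cover_proj (F' (y, t)) = F (cover_proj y, t) &
      forall y, F' (y, zero) = y].

(* x is the class of the trace chain for some homotopy representing g. *)
Definition is_X1 (g : Gamma R X) (x : HH1 G) : Prop :=
  exists F F' M N, [/\ cellular_homotopy g F, lifted_homotopy F F',
    boundary_matrix M, homotopy_matrix F' N &
    represents (trace_chain M (total_homotopy N)) x].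

End Invariant.

Section Derivations.
Variables (Q : groupType) (M : zmodType) (act : Q -> M -> M).

Definition derivation (D : Q -> M) : Prop :=
  forall a b, D (a * b)%g = D a + act a (D b).

(* Derivations into a submodule N are functions to M with values in N. *)
Definition cohomologous (N : set M) (D D' : Q -> M) : Prop :=
  exists2 m, N m & forall a, D a - D' a = m - act a m.
End Derivations.

Section CharacteristicClass.
Variables (R : realType) (X : topologicalType) (x0 : X).
Notation G := (pi1 R x0).

(* The action is by chain maps because the Gottlieb subgroup is central. *)
Definition Gamma_act (g : Gamma R X) : HH1 G -> HH1 G :=
  HH1_rmul ((eta_sharp x0 g)^-1)%g.

Definition HH1' : set (HH1 G) := HH1_at (Gottlieb R x0).
Definition pi' : HH1 G -> HH1 G := HH1_proj (Gottlieb R x0).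
Definition component (c : G) : HH1 G -> HH1 G := HH1_proj (conj_class c).

(* The class of pi' \o X1 in H^1(Gamma_X, HH_1(ZG)'), as the set of derivations
   representing it. *)
Definition chi1 (X1 : Gamma R X -> HH1 G) : set (Gamma R X -> HH1 G) :=
  [set D | [/\ forall g, HH1' (D g), derivation Gamma_act D &
               cohomologous Gamma_act HH1' (pi' \o X1) D]].
End CharacteristicClass.

Definition cyclic_subgroup (H : groupType) (g : H) : set H :=
  [set h | exists n, h = (g ^+ n)%g \/ h = (g ^- n)%g].

(* Main.v *)
Require Import Defs.
From HB Require Import structures.
From mathcomp Require Import all_boot all_order all_algebra.
From mathcomp Require Import all_classical all_reals all_analysis.
From mathcomp Require Import generic_quotient lra homotopy freeg.

Set Implicit Arguments.
Unset Strict Implicit.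
Unset Printing Implicit Defensive.

Import Order.TTheory GRing.Theory Num.Theory numFieldNormedType.Exports.

Local Open Scope classical_set_scope.
Local Open Scope quotient_scope.
Local Open Scope ring_scope.

(** The group Gamma_X is abelian and the Gottlieb subgroup is central in G; both
    follow from commuting squares of loops ([pi1_comm_square]), with the squares
    (s, t) |-> v(s) o w(t) in X^X and (s, t) |-> w(s)(p(t)) in X.  Both are
    continuous because X, a finite CW complex, is compact Hausdorff.

    Let sigma be in Gamma_X, put z = eta(gamma), a = eta(sigma), x = Delta(gamma),
    y = Delta(sigma).  Expanding Delta on gamma sigma = sigma gamma gives
      (1 - sigma) x = (1 - gamma) y.
    Multiplication by a central element translates the components of HH_1
    ([HH1_proj_rmul]), so this equation can be read off component by component.
    Let c be the one component where x does not vanish and suppose that a is not a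
    power of z.  Then the part of (1 - sigma) x lying over the coset c <z> is just
    x_c, so x_c would be the value of 1 - gamma on an element supported over c <z>.
    This is absurd.  If z has finite order n, the norm 1 + gamma + ... +
    gamma^(n-1) annihilates such values, since gamma^n acts trivially, but it maps
    x_c to an element with component x_c at c.  If z has infinite order, y, having
    finitely many non-zero components, would vanish over the whole of c <z>, hence
    x_c = 0.  So every a = eta(sigma) is a power of z ([concentrated_generates]). *)

(** * Commuting loops *)

Section Torus.
Variables (R : realType) (Y : topologicalType) (y : Y).
Notation I := (unitI R).

Lemma toI_le0 (x : R) : x <= 0 -> toI x = zero.
Proof. by move=> x0; apply: Ival_inj; rewrite Ival0 toIE max_l // ge_min x0 orbT. Qed.

Lemma toI_ge1 (x : R) : 1 <= x -> toI x = one.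
Proof. by move=> x1; apply: Ival_inj; rewrite Ival1 toIE min_l // max_r. Qed.

(** The map H sends the two paths from (0, 0) to (1, 1) along the boundary of the
    square to a * b and b * a; the two paths are joined by a family of paths with
    the same end points. *)
Lemma pi1_comm_square (a b : loopType R Y y) (H : I * I -> Y) :
  continuous H ->
  (forall s, H (s, zero) = a s) -> (forall s, H (s, one) = a s) ->
  (forall t, H (zero, t) = b t) -> (forall t, H (one, t) = b t) ->
  (pi1_class a * pi1_class b = pi1_class b * pi1_class a)%g.
Proof.
move=> cH Ha0 Ha1 Hb0 Hb1; rewrite [LHS]pi1_mulE [RHS]pi1_mulE.
apply/eqP/pi1_classP.
(* At time u the path is t |-> (2t - u, 2t - 1 + u), truncated to the square by
   toI: for u = 0 it runs along the bottom and then the right edge, for u = 1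
   along the left and then the top edge. *)
exists (fun ut => H (toI (2 * Ival ut.2 - Ival ut.1),
                     toI (2 * Ival ut.2 - 1 + Ival ut.1))); split.
- apply: continuous_comp2 => //; apply: continuous_toI => z; last first.
    apply: cvgD; last exact: continuous_I1.
    exact: (continuous_scaleB (@continuous_I2 R I)).
  apply: cvgB; last exact: continuous_I1.
  exact: (continuous_scale (@continuous_I2 R I)).
- move=> t /=; rewrite Ival0 subr0 addr0 concatE /concat_fun.
  have [t2|t2] := leP (Ival t) 2^-1; first by rewrite [X in (_, X)]toI_le0 ?Ha0 //; lra.
  by rewrite toI_ge1 ?Hb1 //; lra.
- move=> t /=; rewrite Ival1 subrK concatE /concat_fun.
  have [t2|t2] := leP (Ival t) 2^-1; first by rewrite toI_le0 ?Hb0 //; lra.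
  by rewrite [X in (_, X)]toI_ge1 ?Ha1 //; lra.
- move=> s /=; have := Ival_ge0 s; have := Ival_le1 s; rewrite Ival0 Ival1 => s1 s0.
  split.
    by rewrite (@toI_le0 (2 * 0 - _)) ?(@toI_le0 (2 * 0 - 1 + _)) ?Ha0 ?path_zero //; lra.
  by rewrite (@toI_ge1 (2 * 1 - _)) ?(@toI_ge1 (2 * 1 - 1 + _)) ?Ha1 ?path_one //; lra.
Qed.

End Torus.

(** * Finite CW complexes are compact *)

Section Compactness.
Variable R : realType.

(** The disk type carries the subspace topology, so it is the image of the closed
    unit ball under the corestriction of the identity. *)
Lemma disk_compact k : compact [set: disk R k].
Proof.
pose A := [set v : 'rV[R]_k | \sum_i v ord0 i ^+ 2 <= 1].
have csq : continuous (fun v : 'rV[R]_k => \sum_i v ord0 i ^+ 2).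
  apply: continuous_big => [|i _ v]; first exact: add_continuous.
  apply: (@continuous_comp _ _ _ (fun v : 'rV[R]_k => v ord0 i) (fun x : R => x ^+ 2)).
    exact: coord_continuous.
  exact: exprn_continuous.
have cptA : compact A.
  apply: bounded_closed_compact; last first.
    apply: (@closed_comp _ _ _ [set x : R | x <= 1]); last exact: closed_le.
    by move=> v _; exact: csq.
  exists 1; split=> // M M1 v /= Av.
  rewrite /Num.norm /= mx_normrE; apply: bigmax_le => [|[i j] _ /=].
    by rewrite (le_trans _ (ltW M1)).
  rewrite ord1 (le_trans _ (ltW M1)) // -(@ler_pXn2r _ 2) ?nnegrE // expr1n.
  rewrite real_normK ?num_real //; apply: le_trans Av.
  by rewrite (bigD1 j) //= lerDl sumr_ge0 // => *; exact: sqr_ge0.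
have A0 : 0 \in A.
  by rewrite inE /A /= big1 // => i _; rewrite mxE expr0n.
pose d0 : disk R k := exist _ 0 A0.
pose g (v : 'rV[R]_k) : disk R k := insubd d0 v.
have gE v : A v -> set_val (g v) = v.
  by move=> Av; rewrite /g /insubd insubT //; exact: mem_set.
have -> : [set: disk R k] = g @` A.
  apply/seteqP; split=> // d _; exists (set_val d); first exact: set_valP.
  by apply: val_inj; apply: gE; exact: set_valP.
apply: continuous_compact => //.
apply: continuous_comp_initial.
apply: (@subspace_eq_continuous _ A 'rV[R]_k id).
  by move=> v /set_mem Av /=; rewrite /from_subspace /= gE.
by apply: continuous_subspaceT => v; exact: cvg_id.
Qed.

Lemma finCW_compact (X : topologicalType) (K : finCW R X) : compact [set: X].
Proof.
have cchar (e : cell K) : continuous (@charmap _ _ K e) by case: K e.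
have coverX : [set: X] `<=` \big[setU/set0]_(e : cell K) range (@charmap _ _ K e).
  move=> y _; have [e [v <-]] : exists e (v : disk R (cdim e)), @charmap _ _ K e v = y.
    case: K {cchar} => I d f ? ? part ?; have [[e v] [[_ /= <-] _]] := part y.
    by exists e, v.
  by rewrite (bigD1 e) //=; left; exists v.
have := @bigsetU_compact X _ (fun e => range (@charmap _ _ K e)) (index_enum (cell K)) xpredT.
rewrite (_ : \big[_/_]_(_ <- _ | _) _ = setT); last by apply/seteqP; split.
apply=> e _; apply: continuous_compact; last exact: disk_compact.
by apply: continuous_subspaceT; exact: cchar.
Qed.

Lemma finCW_hausdorff (X : topologicalType) (K : finCW R X) : hausdorff_space X.
Proof. by case: K. Qed.

End Compactness.

Lemma compact_locally_compact (T : topologicalType) :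
  compact [set: T] -> locally_compact [set: T].
Proof.
move=> cT t _; exists setT; last by split; last exact: closedT.
by rewrite withinET; exact: filterT.
Qed.

(** * Commutativity of Gamma and centrality of the Gottlieb subgroup *)

Section Gottlieb.
Variables (R : realType) (X : topologicalType) (x0 : X) (K : finCW R X).
Notation I := (unitI R).

(** The exponential law for maps out of a locally compact Hausdorff space: loops
    in the compact-open topology are homotopies. *)
Lemma self_loop_continuous (w : loopType R (selfmaps X) (selfid X)) :
  continuous (fun tx : I * X => (w tx.1 : continuousType X X) tx.2).
Proof.
have cX := finCW_compact K.
pose f (t : I) : {compact-open, X -> X} := (w t : continuousType X X).
rewrite [X in continuous X](_ : _ = uncurry f); last by apply/funext => -[].
apply: continuous_uncurry.
- exact: compact_locally_compact.
- exact: finCW_hausdorff K.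
- move=> t; apply: (@continuous_comp _ _ _ w (fun h : selfmaps X =>
    (h : continuousType X X) : {compact-open, X -> X})); first exact: cts_fun.
  exact: initial_continuous.
- by move=> t; exact: cts_fun.
Qed.

(** The Eckmann-Hilton argument, with composition of self-maps as second product. *)
Lemma Gamma_comm (a b : Gamma R X) : (a * b = b * a)%g.
Proof.
rewrite -(pi1_classK a) -(pi1_classK b); set v := repr a; set w := repr b.
have cH : continuous (fun stx : I * I * X =>
    (v stx.1.1 : continuousType X X) ((w stx.1.2 : continuousType X X) stx.2)).
  apply: (continuous_comp2 (f := fun stx : I * I * X => stx.1.1)
    (g := fun stx : I * I * X => (w stx.1.2 : continuousType X X) stx.2)
    (h := fun tx : I * X => (v tx.1 : continuousType X X) tx.2)).
  - move=> z; apply: (@continuous_comp _ _ _ fst fst); exact: cvg_fst.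
  - apply: (continuous_comp2 (f := fun stx : I * I * X => stx.1.2) (g := snd)
      (h := fun tx : I * X => (w tx.1 : continuousType X X) tx.2)).
    + by move=> z; apply: (@continuous_comp _ _ _ fst snd); [exact: cvg_fst|exact: cvg_snd].
    + by move=> z; exact: cvg_snd.
    + exact: self_loop_continuous.
  - exact: self_loop_continuous.
have [cHc _] := continuous_curry cH.
pose H (st : I * I) : selfmaps X :=
  [the continuousType X X of (v st.1 : continuousType X X) \o (w st.2 : continuousType X X)].
apply: (@pi1_comm_square _ _ _ _ _ H).
- apply: (@continuous_comp_initial (continuousType X X) _ _
    (id : continuousType X X -> {compact-open, X -> X})).
  exact: cHc.
- by move=> s; apply/continuousEP => y; rewrite /= path_zero.
- by move=> s; apply/continuousEP => y; rewrite /= path_one.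
- by move=> s; apply/continuousEP => y; rewrite /= path_zero.
- by move=> s; apply/continuousEP => y; rewrite /= path_one.
Qed.

Lemma eta_sharp_central (a : Gamma R X) (g : pi1 R x0) :
  (eta_sharp x0 a * g = g * eta_sharp x0 a)%g.
Proof.
rewrite -(pi1_classK a) -(pi1_classK g) /eta_sharp pi1_mapE.
set w := repr a; set p := repr g.
apply: (@pi1_comm_square _ _ _ _ _ (fun st : I * I => (w st.1 : continuousType X X) (p st.2))).
- apply: (continuous_comp2 (f := fst) (g := fun st : I * I => p st.2)
    (h := fun tx : I * X => (w tx.1 : continuousType X X) tx.2)).
  + by move=> z; exact: cvg_fst.
  + move=> z; apply: (@continuous_comp _ _ _ snd p); [exact: cvg_snd|exact: cts_fun].
  + exact: self_loop_continuous.
- by move=> s; rewrite /= path_zero.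
- by move=> s; rewrite /= path_one.
- by move=> s; rewrite /= path_zero.
- by move=> s; rewrite /= path_one.
Qed.

Lemma eta_sharpM : {morph @eta_sharp R X x0 : a b / (a * b)%g}.
Proof. by move=> a b; rewrite /eta_sharp pi1_mapM. Qed.

Lemma eta_sharpV : {morph @eta_sharp R X x0 : a / (a^-1)%g}.
Proof.
have eta1 : eta_sharp x0 (1%g : Gamma R X) = 1%g.
  by apply: (mulgI (eta_sharp x0 1%g)); rewrite -eta_sharpM !mulg1.
by move=> a; apply: (mulgI (eta_sharp x0 a)); rewrite -eta_sharpM !mulgV.
Qed.

End Gottlieb.

(** * Components of first Hochschild homology *)

Section HH1Components.
Variable G : groupType.
Implicit Types (c d z w : G) (x y : HH1 G).

Definition central z := forall g, (z * g = g * z)%g.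

Lemma centralV z : central z -> central z^-1%g.
Proof. by move=> zC g; rewrite -[g in LHS](mulgK z) -zC !mulgA mulVg mul1g. Qed.

Lemma conj_class_central c : central c -> conj_class c = [set c].
Proof.
move=> cC; apply/seteqP; split=> [_ [a ->]|_ ->] /=.
  by rewrite -mulgA cC mulgA mulVg mul1g.
by exists 1%g; rewrite mulg1 invg1 mul1g.
Qed.

Lemma represents_ex x : exists a, represents a x.
Proof. by exists (val (repr x)), (repr x); rewrite // /HH1_class reprK. Qed.

Lemma represents0 : represents (0 : HC1 G) 0.
Proof.
exists 0 => //; exact: (raddf0 (\pi_(@Quotient.quot (HZ1 G) (@hboundary G)))).
Qed.

Lemma representsB (a b : HC1 G) x y :
  represents a x -> represents b y -> represents (a - b) (x - y).
Proof.
move=> [u <- <-] [v <- <-]; exists (u - v) => //.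
exact: (raddfB (\pi_(@Quotient.quot (HZ1 G) (@hboundary G)))).
Qed.

Lemma represents_inj (a : HC1 G) x y : represents a x -> represents a y -> x = y.
Proof. by move=> [u ua <-] [v va <-]; congr HH1_class; apply: val_inj; rewrite /= ua. Qed.

Lemma represents_proj c (a : HC1 G) x : represents a x ->
  represents (fgrestrict [set s | conj_class c (marker s)] a)
             (HH1_proj (conj_class c) x).
Proof.
move=> [w <- <-]; apply: HH1_projE => _ b [g ->].
by exists (g * b)%g; rewrite invgM !mulgA.
Qed.

Lemma represents_rmul z (a : HC1 G) x : central z -> represents a x ->
  represents (fgpush (fun s => (s.1, (s.2 * z)%g)) a) (HH1_rmul z x).
Proof. by move=> zC [w <- <-]; exact: HH1_rmulE. Qed.

Lemma HH1_projB c : {morph HH1_proj (conj_class c) : x y / x - y}.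
Proof.
move=> x y; have [a ax] := represents_ex x; have [b bY] := represents_ex y.
apply: represents_inj (represents_proj c (representsB ax bY)) _.
rewrite /fgrestrict fglift_raddf.
by apply: representsB; exact: represents_proj.
Qed.

Lemma HH1_rmul0 z : central z -> HH1_rmul z (0 : HH1 G) = 0.
Proof.
move=> zC; apply: represents_inj (represents_rmul zC represents0) _.
by rewrite /fgpush fglift0; exact: represents0.
Qed.

Lemma HH1_rmul1 x : HH1_rmul 1%g x = x.
Proof.
have [a ax] := represents_ex x.
have oneC : central 1%g by move=> g; rewrite mul1g mulg1.
apply: represents_inj (represents_rmul oneC ax) _.
rewrite (_ : fgpush _ a = a) // {x ax}; elim/freegP: a => [|[g m]|a b aE bE].
- by rewrite /fgpush fglift0.
- by rewrite /fgpush fglift1 /= mulg1.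
- by rewrite [LHS]fglift_raddf; congr (_ - _).
Qed.

Lemma HH1_rmulM z w x : central z -> central w ->
  HH1_rmul z (HH1_rmul w x) = HH1_rmul (w * z)%g x.
Proof.
move=> zC wC; have wzC : central (w * z)%g.
  by move=> g; rewrite -mulgA (zC g) mulgA (wC g) mulgA.
have [a ax] := represents_ex x.
apply: represents_inj (represents_rmul zC (represents_rmul wC ax)) _.
rewrite [fgpush _ (fgpush _ a)](_ : _ = fgpush (fun s => (s.1, (s.2 * (w * z))%g)) a).
  exact: represents_rmul.
rewrite {x ax}; elim/freegP: a => [|[g m]|a b aE bE].
- by rewrite /fgpush !fglift0.
- by rewrite /fgpush !fglift1 /= mulgA.
- by move: aE bE; rewrite /fgpush !fglift_raddf => -> ->.
Qed.

(** The marker of s (x) m z is the marker of s (x) m times z. *)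
Lemma HH1_proj_rmul d z x : central z ->
  HH1_proj (conj_class d) (HH1_rmul z x) =
  HH1_rmul z (HH1_proj (conj_class (d * z^-1)%g) x).
Proof.
move=> zC; have [a ax] := represents_ex x.
apply: represents_inj (represents_proj d (represents_rmul zC ax)) _.
have classE g : conj_class d (g * z)%g <-> conj_class (d * z^-1)%g g.
  have dzE b : (b^-1 * (d * z^-1) * b = b^-1 * d * b * z^-1)%g.
    by rewrite -!mulgA (centralV zC b).
  by split=> -[b e]; exists b; rewrite ?dzE -?e ?mulgK // e dzE mulgVK.
rewrite [fgrestrict _ _](_ : _ = fgpush (fun s => (s.1, (s.2 * z)%g))
    (fgrestrict [set s | conj_class (d * z^-1)%g (marker s)] a)).
  by apply/represents_rmul => //; exact: represents_proj.
rewrite {x ax}; elim/freegP: a => [|[g m]|a b aE bE].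
- by rewrite /fgpush /fgrestrict !fglift0.
- rewrite /fgpush /fgrestrict !fglift1 /marker /= mulgA.
  case: asboolP => [/classE|] dm; case: asboolP => // dm'.
    by rewrite fglift1.
  - by case: dm; exact/classE.
  - by rewrite fglift0.
- by move: aE bE; rewrite /fgpush /fgrestrict !fglift_raddf => -> ->.
Qed.

(** The markers of a chain representing x are finite in number, and a central
    class consists of one marker. *)
Lemma HH1_proj_finite x : exists s : seq G, forall d, central d -> d \notin s ->
  HH1_proj (conj_class d) x = 0.
Proof.
have [a ax] := represents_ex x.
suff [s sP] : exists s : seq G, forall d, central d -> d \notin s ->
    fgrestrict [set s | conj_class d (marker s)] a = 0.
  exists s => d dC ds; apply: represents_inj represents0.
  by rewrite -(sP d dC ds); exact: represents_proj.
rewrite {x ax}; elim/freegP: a => [|k|a b [s sP] [t tP]].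
- by exists [::] => d _ _; rewrite /fgrestrict fglift0.
- exists [:: marker k] => d dC; rewrite inE /fgrestrict fglift1 => /eqP dk.
  by rewrite conj_class_central //; case: asboolP => // kd; case: dk.
- exists (s ++ t) => d dC; rewrite mem_cat negb_or => /andP[ds dt].
  by move: (sP d dC ds) (tP d dC dt); rewrite /fgrestrict fglift_raddf => -> ->; rewrite subr0.
Qed.

Lemma HH1_proj_seq (f : nat -> G) x : injective f -> (forall n, central (f n)) ->
  exists n, HH1_proj (conj_class (f n)) x = 0.
Proof.
move=> finj fC; have [s sP] := HH1_proj_finite x.
apply: contrapT => /forallNP neq0.
have fs n : f n \in s by apply/negPn/negP => /(sP _ (fC n)) /neq0.
have: (size (map f (iota 0 (size s).+1)) <= size s)%N.
  by apply: uniq_leq_size; [rewrite map_inj_uniq // iota_uniq|move=> _ /mapP[n _ ->]].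
by rewrite size_map size_iota ltnn.
Qed.

End HH1Components.

(** * Concentration in one component forces cyclicity *)

Section CyclicFromConcentrated.
Variables (G : groupType) (S : set G).
Hypotheses (SC : forall g, S g -> central g)
  (SM : forall g h, S g -> S h -> S (g * h)%g) (SV : forall g, S g -> S g^-1%g).

Lemma subgroupX g n : S g -> S (g ^+ n)%g.
Proof.
move=> Sg; elim: n => [|n IH]; last by rewrite expgS; exact: SM.
by rewrite expg0 -(mulgV g); apply/SM/SV.
Qed.

Lemma iter_rmul z n (x : HH1 G) : S z ->
  iter n (HH1_rmul z) x = HH1_rmul (z ^+ n)%g x.
Proof.
move=> Sz; elim: n => [|n IH]; first by rewrite HH1_rmul1.
by rewrite iterS IH HH1_rmulM ?expgSr //; apply: SC => //; exact: subgroupX.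
Qed.

(** Here S is a central subgroup.  If a is not in <z>, then over the coset c <z> the
    term x a^-1 vanishes, and the equation is a recursion for the components of y:
    moving from c w to c w z loses nothing unless w = 1, where the jump is x_c.
    Going once around the coset (z of finite order), or in both directions until
    the support of y is left (z of infinite order), shows that the jump is zero. *)
Lemma concentrated_generates (a z c : G) (x y : HH1 G) :
  S a -> S z -> S c ->
  x - HH1_rmul a^-1%g x = y - HH1_rmul z^-1%g y ->
  HH1_proj (conj_class c) x <> 0 ->
  (forall d, S d -> HH1_proj (conj_class d) x <> 0 -> d = c) ->
  cyclic_subgroup z a.
Proof.
move=> Sa Sz Sc xy xc xd; apply: contrapT => za.
pose e d := HH1_proj (conj_class d) y.
have CV g : S g -> central g^-1%g by move=> /SV/SC.
have xcE w : cyclic_subgroup z w -> S w ->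
    HH1_proj (conj_class (c * w)%g) x = e (c * w)%g - HH1_rmul z^-1%g (e (c * w * z)%g).
  move=> zw Sw; move: (congr1 (HH1_proj (conj_class (c * w)%g)) xy).
  rewrite !HH1_projB !HH1_proj_rmul ?invgK; [|exact: CV..].
  rewrite [X in HH1_rmul a^-1%g X](_ : _ = 0).
    by rewrite HH1_rmul0 ?subr0 //; exact: CV.
  apply: contrapT => /xd; rewrite -mulgA => /(_ (SM Sc (SM Sw Sa))).
  rewrite -[RHS]mulg1 => /mulgI wa; apply: za.
  have -> : a = w^-1%g by rewrite -[LHS](mulKg w) wa mulg1.
  by have [n [->|->]] := zw; exists n; [right|left; rewrite invgK].
have step w : cyclic_subgroup z w -> S w -> w <> 1%g ->
    e (c * w)%g = HH1_rmul z^-1%g (e (c * w * z)%g).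
  move=> zw Sw w1; apply: subr0_eq; rewrite -xcE //; apply: contrapT => /(xd _ (SM Sc Sw)).
  by rewrite -[RHS]mulg1 => /mulgI.
have {xcE} xcE : HH1_proj (conj_class c) x = e c - HH1_rmul z^-1%g (e (c * z)%g).
  rewrite -[c]mulg1; apply: xcE; first by exists 0%N; left.
  by rewrite -(expg0 z); exact: subgroupX.
have along m : (forall i, (0 < i <= m)%N -> z ^+ i <> 1)%g ->
    e (c * z)%g = HH1_rmul (z^-1 ^+ m)%g (e (c * z ^+ m.+1)%g).
  rewrite -iter_rmul; last exact: SV.
  elim: m => [|m IH] zm; first by rewrite expg1.
  rewrite IH => [|i /andP[i0 im]]; last by apply: zm; rewrite i0 leqW.
  rewrite iterSr (step (z ^+ m.+1)%g) -?mulgA -?expgSr //.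
  - by exists m.+1; left.
  - exact: subgroupX.
  - by apply: zm; rewrite /= ltnSn.
(* Finite order: z ^+ m.+1 = 1 with m.+1 least, so that the recursion runs from
   c z to c z ^+ m.+1 = c without meeting the jump. *)
have [[n n0 zn]|zinf] := pselect (exists2 n, (0 < n)%N & (z ^+ n = 1)%g).
  have ex : exists n, (0 < n)%N && `[< (z ^+ n = 1)%g >].
    by exists n; rewrite n0; exact/asboolP.
  have [[//|m] /andP[_ /asboolP zm] mmin] := ex_minnP ex.
  apply: xc; rewrite xcE (along m) => [|i /andP[i0 im] zi].
    rewrite zm mulg1 HH1_rmulM; [|exact: CV|exact/SC/subgroupX/SV].
    by rewrite -expgSr expVgn zm invg1 HH1_rmul1 subrr.
  by have := mmin i; rewrite i0 ltnNge im /=; move/(_ (asboolT zi)).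
have zX i j : (i < j)%N -> (z ^+ i)%g <> (z ^+ j)%g.
  move=> ij zij; apply: zinf; exists (j - i)%N; first by rewrite subn_gt0.
  by rewrite expgnFr ?(ltnW ij) // -zij mulgV.
have zinj : injective (fun i => z ^+ i)%g.
  by move=> i j /= zij; case: (ltngtP i j) => // /zX []; rewrite zij.
(* Infinite order: the recursion maps are bijective, so a zero of y at some
   c z ^+ n.+1 propagates back to c z, and one at c z ^- n forward to c. *)
have ez0 : e (c * z)%g = 0.
  have [||n en0] := @HH1_proj_seq _ (fun n => c * z ^+ n.+1)%g y.
  - by move=> i j /mulgI/zinj [].
  - by move=> n; apply/SC/SM => //; exact: subgroupX.
  rewrite (along n) => [|i /andP[i0 _] zi]; last by apply: zinf; exists i.
  by rewrite [e _]en0 HH1_rmul0 //; exact/SC/subgroupX/SV.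
have ec0 : e c = 0.
  have [||n en0] := @HH1_proj_seq _ (fun n => c * z ^- n)%g y.
  - by move=> i j /mulgI/(can_inj (@invgK _))/zinj.
  - by move=> n; exact/SC/SM/SV/subgroupX.
  elim: n en0 => [|n IH] en0; first by move: en0; rewrite expg0 invg1 mulg1.
  apply: IH; rewrite -[LHS]HH1_rmul1 -(mulVg z) -HH1_rmulM; [|exact: SC|exact: CV].
  have znS : (z ^- n.+1 * z = z ^- n)%g by rewrite expgS invgM mulgVK.
  have := step (z ^- n.+1)%g; rewrite -mulgA znS [e _]en0 => <-.
  - by rewrite HH1_rmul0 //; exact: SC.
  - by exists n.+1; right.
  - exact/SV/subgroupX.
  - move=> /(congr1 (fun g => g^-1)%g); rewrite invgK invg1 => zn; apply: zinf.
    by exists n.+1.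
by apply: xc; rewrite xcE ec0 ez0 HH1_rmul0 ?subrr //; exact: CV.
Qed.

End CyclicFromConcentrated.

Theorem theoremA2 (R : realType) (X : topologicalType) (x0 : X) (K : finCW R X)
    (X_connected : connected [set: X])
    (U : universal_cover R x0) (L : cell_lifts K U)
    (X1 : Gamma R X -> HH1 (pi1 R x0)) (X1_spec : forall g, is_X1 L g (X1 g))
    (gamma : Gamma R X) (Delta : Gamma R X -> HH1 (pi1 R x0))
    (Delta_chi1 : chi1 X1 Delta)
    (Delta_one : exists! c : pi1 R x0,
       Gottlieb R x0 c /\ component c (Delta gamma) <> 0) :
  (exists g, Gottlieb R x0 = cyclic_subgroup g) /\
  Gottlieb R x0 = cyclic_subgroup (eta_sharp x0 gamma).
Proof.
suff GE : Gottlieb R x0 = cyclic_subgroup (eta_sharp x0 gamma).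
  by split=> //; exists (eta_sharp x0 gamma).
have SC g : Gottlieb R x0 g -> central g.
  by move=> [s _ <-] h; exact: (eta_sharp_central K).
have SM g h : Gottlieb R x0 g -> Gottlieb R x0 h -> Gottlieb R x0 (g * h)%g.
  by move=> [s _ <-] [t _ <-]; exists (s * t)%g => //; rewrite eta_sharpM.
have SV g : Gottlieb R x0 g -> Gottlieb R x0 g^-1%g.
  by move=> [s _ <-]; exists s^-1%g => //; rewrite eta_sharpV.
have [c [[Sc xc] xd]] := Delta_one.
have [_ derD _] := Delta_chi1.
have Sz : Gottlieb R x0 (eta_sharp x0 gamma) by exists gamma.
apply/seteqP; split=> [_ [s _ <-]|_ [n [->|->]]]; last 2 first.
- exact: (subgroupX SM SV n Sz).
- exact: (SV _ (subgroupX SM SV n Sz)).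
apply: (concentrated_generates (y := Delta s) SC SM SV _ _ Sc _ xc)
  => [|||d Sd nz].
- by exists s.
- by exists gamma.
- change (Delta gamma - Gamma_act s (Delta gamma) =
          Delta s - Gamma_act gamma (Delta s)).
  apply/eqP; rewrite subr_eq addrAC eq_sym subr_eq; apply/eqP.
  by rewrite -!derD (Gamma_comm K).
- exact/esym/xd.
Qed.
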